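(* For every integer $n\geq 0$ and indeterminate $y$, $$\sum_{k=0}^{n}(-1)^{n-k}\binom{n}{k}A_{n,k}(y+1)^{k}=\sum_{k=0}^{n}\binom{n}{k}y^{k}B_{k},$$ or equivalently $$\sum_{k=0}^{n}\binom{n}{k}A_{n,k}y^{k}=\sum_{k=0}^{n}(-1)^{n-k}\binom{n}{k}(y+1)^{k}B_{k}.$$
   Context: A partition of a finite set is a collection of nonempty, pairwise disjoint subsets (blocks) whose union is the set; a singleton of a partition is a block with exactly one element. $B_n$ denotes the $n$-th Bell number ($B_0=1$). For integers $0\leq k\leq n$, $A_{n,k}$ denotes the number of partitions of $\{1,2,\dots,n+1\}$ whose largest singleton is $k+1$ (i.e. $\{k+1\}$ is a block and no $j>k+1$ forms a singleton block). *)

(* Defs.v *)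
From mathcomp Require Import all_boot all_order all_algebra.

Set Implicit Arguments.
Unset Strict Implicit.
Unset Printing Implicit Defensive.

Definition set_partitions (T : finType) : {set {set {set T}}} :=
  [set P : {set {set T}} | partition P [set: T]].

Definition bell (n : nat) : nat := #|set_partitions 'I_n|.

(* The ground set {1, ..., n+1} is represented by 'I_n.+1, the ordinal of value
   i standing for the element i+1; so k below stands for the element k+1. *)
Definition largest_singleton (n : nat) (P : {set {set 'I_n.+1}})
    (k : 'I_n.+1) : bool :=
  ([set k] \in P) && [forall j : 'I_n.+1, (k < j) ==> ([set j] \notin P)].

Definition A (n : nat) (k : 'I_n.+1) : nat :=
  #|[set P in set_partitions 'I_n.+1 | largest_singleton P k]|.

(* Main.v *)
Require Import Defs.
From mathcomp Require Import all_boot all_order all_algebra.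
From mathcomp Require Import ring.
Import GRing.Theory.
Local Open Scope ring_scope.

(** Let f(D, E) be the number of partitions of D in which no element of the
    subset E is a singleton. Deleting the block {k+1} shows that A_(n,k) is
    f(D, E) with #|D| = n and #|E| = n - k. For x in E,
    f(D, E) = f(D, E - x) - f(D - x, E - x), hence
    A_(n,k) = sum_m (-1)^(n-m) C(n-k, n-m) B_m. As
    C(n,k) C(n-k,n-m) = C(n,m) C(m,k), the binomial theorem gives the second
    identity, for y in any commutative ring; the first one is its instance at
    - (y + 1). *)

Definition partitions_avoiding {T : finType} (D E : {set T}) :
    {set {set {set T}}} :=
  [set P | partition P D & [forall x in E, [set x] \notin P]].

(** Relabelling along the enumeration [f] of [D]: taking images blockwise is injective on families
    of sets and reaches every partition of [D]. *)
Lemma card_partitions (T : finType) (D : {set T}) :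
  #|[set P | partition P D]| = bell #|D|.
Proof.
pose f : 'I_#|D| -> T := enum_val.
have f_inj : injective f by exact: enum_val_inj.
have fT : f @: [set: 'I_#|D|] = D.
  apply/setP => x; apply/imsetP/idP => [[i _ ->]|Dx]; first exact: enum_valP.
  by exists (enum_rank_in Dx x); rewrite ?inE // /f enum_rankK_in.
pose F (P : {set {set 'I_#|D|}}) := [set f @: (B : {set _}) | B in P].
have F_inj : injective F by apply: imset_inj; apply: imset_inj.
rewrite /bell -(card_imset _ F_inj); apply: eq_card => P.
apply/idP/imsetP => [|[Q]]; rewrite !inE; last first.
  by move=> partQ ->; rewrite -[X in partition _ X]fT imset_partition.
move=> partP; pose Q := [set f @^-1: (B : {set T}) | B in P].
(* Each block of [P] lies in [D], the range of [f], so it is the image of its preimage. *)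
have defP : P = F Q.
  rewrite /F /Q -imset_comp -[LHS]imset_id; apply: eq_in_imset => B BP /=.
  apply/setP => x; apply/idP/imsetP => [Bx|[i]]; last first.
    by rewrite !inE => fiB ->.
  have: x \in f @: [set: 'I_#|D|].
    by rewrite fT (subsetP (partitionS partP BP)).
  by case/imsetP => i _ xE; exists i; rewrite // inE -xE.
exists Q => //.
by rewrite inE -(imset_partition _ _ f_inj) fT -/(F Q) -defP.
Qed.

(** Adding the block [[set x]] is a bijection, undone by deleting it; since [x] is outside [E], the
    new block violates no avoidance condition. *)
Lemma card_partitions_with_singleton (T : finType) (D E : {set T}) (x : T) :
  x \in D -> x \notin E ->
  #|[set P in partitions_avoiding D E | [set x] \in P]|
    = #|partitions_avoiding (D :\ x) E|.
Proof.
move=> Dx Ex.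
have notinQ Q : partition Q (D :\ x) -> [set x] \notin Q.
  move=> partQ; apply/negP => /(partitionS partQ)/subsetP/(_ x).
  by rewrite !inE eqxx => /(_ isT).
have avoidU Q : [forall z in E, [set z] \notin [set x] |: Q]
    = [forall z in E, [set z] \notin Q].
  apply: eq_forallb_in => z Ez; rewrite !inE negb_or (inj_eq set1_inj).
  by case: eqP => // zx; rewrite -zx Ez in Ex.
have addx_inj : {in partitions_avoiding (D :\ x) E &,
    injective (fun Q => [set x] |: Q)}.
  move=> Q1 Q2; rewrite !inE => /andP[/notinQ Q1x _] /andP[/notinQ Q2x _] eqQ.
  by rewrite -(setU1K Q1x) eqQ setU1K.
rewrite -(card_in_imset addx_inj); apply: eq_card => P.
apply/idP/imsetP => [|[Q]]; rewrite !inE.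
  case/andP => /andP[partP avoidP] xP.
  exists (P :\ [set x]); last by rewrite setD1K.
  by rewrite inE partitionD1 // -avoidU setD1K.
case/andP => partQ avoidQ ->; rewrite avoidU avoidQ !inE eqxx /= !andbT.
rewrite -(setD1K Dx); apply: partitionU1 => //.
  by apply/set0Pn; exists x; rewrite inE.
by rewrite disjoints1 !inE eqxx.
Qed.

(** The recurrence in subtraction-free form: partitions are sorted by whether [[set x]] is a
    block. *)
Lemma card_partitions_avoidingU1 (T : finType) (D E : {set T}) (x : T) :
  x \in D -> x \notin E ->
  #|partitions_avoiding D E|
    = (#|partitions_avoiding (D :\ x) E| + #|partitions_avoiding D (x |: E)|)%N.
Proof.
move=> Dx Ex.
rewrite -(card_partitions_with_singleton _ _ _ _ Dx Ex).
rewrite -(cardsID [set P : {set {set T}} | [set x] \in P]).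
congr (_ + _)%N; apply: eq_card => P; rewrite !inE //.
rewrite andbCA; congr (_ && _); apply/idP/idP => [/andP[xP /forall_inP avoidP]|].
  by apply/forall_inP => z /setU1P[-> //|]; apply: avoidP.
move=> /forall_inP avoidP; rewrite avoidP ?setU11 //=.
by apply/forall_inP => z Ez; apply: avoidP; rewrite setU1r.
Qed.

Lemma card_partitions_avoiding (R : comNzRingType) (T : finType)
    (D E : {set T}) :
  E \subset D ->
  (#|partitions_avoiding D E|)%:R
    = \sum_(m < #|D|.+1) (-1) ^+ (#|D| - m) * 'C(#|E|, #|D| - m)%:R
                           * (bell m)%:R :> R.
Proof.
have [e] := ubnP #|E|; elim: e D E => // e IH D E cardE sED.
(* For empty [E] the factor ['C(0, #|D| - m)] leaves only the term [m = #|D|], a Bell number. *)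
have [->|[x Ex]] := set_0Vmem E.
  have -> : partitions_avoiding D set0 = [set P | partition P D].
    apply/setP => P; rewrite !inE; case: partition => //=.
    by apply/forall_inP => x; rewrite inE.
  rewrite card_partitions big_ord_recr /= subnn cards0 expr0 !mul1r.
  rewrite big1 ?add0r // => m _.
  by rewrite bin_small ?mulr0 ?mul0r // subn_gt0.
have Dx := subsetP sED x Ex.
have Ex' : x \notin E :\ x by rewrite !inE eqxx.
have cardEx : (#|E :\ x| < e)%N
  by move: cardE; rewrite (cardsD1 x) Ex.
have sExD : E :\ x \subset D := subset_trans (subsetDl _ _) sED.
have -> : (#|partitions_avoiding D E|)%:R
    = (#|partitions_avoiding D (E :\ x)|)%:R
      - (#|partitions_avoiding (D :\ x) (E :\ x)|)%:R :> R.
  rewrite (card_partitions_avoidingU1 _ D (E :\ x) x) // setD1K //.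
  by rewrite natrD addrAC subrr add0r.
rewrite !(IH _ (E :\ x)) ?setSD //.
rewrite [#|E|](cardsD1 x) [#|D|](cardsD1 x) Ex Dx !add1n.
set d := #|D :\ x|; set f := #|E :\ x|.
(* The sum for [D :\ x] is one term shorter. The top terms [m = d.+1] of the other two agree, and
   below them Pascal's rule applies term by term, the minus sign being absorbed by
   [(-1) ^+ (d.+1 - m)]. *)
rewrite big_ord_recr [in RHS]big_ord_recr /= !subnn !bin0 addrAC; congr (_ + _).
rewrite -sumrB; apply: eq_bigr => m _; have le_md : (m <= d)%N by rewrite -ltnS.
by rewrite subSn // binS natrD mulrDr mulrDl exprS mulN1r !mulNr.
Qed.

Lemma A_bell (R : comNzRingType) (n : nat) (k : 'I_n.+1) :
  (A k)%:R = \sum_(m < n.+1) (-1) ^+ (n - m) * 'C(n - k, n - m)%:R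
                               * (bell m)%:R :> R.
Proof.
pose E := [set j : 'I_n.+1 | (k < j)%N].
have Ek : k \notin E by rewrite inE ltnn.
have cardD : #|[set: 'I_n.+1] :\ k| = n.
  by rewrite cardsDS ?subsetT // cardsT card_ord cards1 subn1.
have cardE : #|E| = (n - k)%N.
  rewrite -sum1_card (eq_bigl (fun j : 'I_n.+1 => (k < j)%N)) => [|j]; last first.
    by rewrite inE.
  rewrite -(big_mkord (fun j => (k < j)%N) (fun=> 1%N)).
  rewrite (big_cat_nat (n := k.+1)) //= big_nat_cond big1 ?add0n; last first.
    by move=> j /andP[/andP[_]]; rewrite ltnS => /leq_gtF ->.
  rewrite big_nat_cond (eq_bigl (fun j => (k.+1 <= j < n.+1)%N)) => [|j].
    by rewrite -big_nat sum_nat_const_nat muln1 subSS.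
  by rewrite andbC andb_idl // => /andP[].
have -> : A k = #|partitions_avoiding ([set: 'I_n.+1] :\ k) E|.
  rewrite -(card_partitions_with_singleton _ _ _ _ (in_setT k) Ek).
  apply: eq_card => P; rewrite !inE /largest_singleton -[in RHS]andbA.
  rewrite [in RHS](andbC _ ([set k] \in P)); congr [&& _, _ & _].
  by apply: eq_forallb => j; rewrite inE.
rewrite card_partitions_avoiding ?cardD ?cardE //.
by rewrite subsetD1 subsetT.
Qed.

(** Both sides count nested pairs of subsets of sizes [k] and [m] in an [n]-set: on the left the
    smaller set is chosen first, then the complement of the larger. For [m < k] both vanish. *)
Lemma mul_bin_bin n m k : (m <= n)%N -> (k <= n)%N ->
  ('C(n, k) * 'C(n - k, n - m) = 'C(n, m) * 'C(m, k))%N.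
Proof.
move=> le_mn le_kn; have [le_km|lt_mk] := leqP k m; last first.
  rewrite (bin_small lt_mk) [X in (_ * X)%N]bin_small ?muln0 //.
  by rewrite ltn_sub2l // (leq_trans lt_mk).
apply/eqP; rewrite -(@eqn_pmul2r (k`! * (m - k)`! * (n - m)`!)) //; last first.
  by rewrite !muln_gt0 !fact_gt0.
have nkE : (n - k - (n - m) = m - k)%N by rewrite subnAC subKn.
have := bin_fact (leq_sub2l n le_km); rewrite nkE => Enk.
apply/eqP; transitivity n`!.
  by rewrite -(bin_fact le_kn) -Enk; ring.
by rewrite -(bin_fact le_mn) -(bin_fact le_km); ring.
Qed.

Lemma sum_A_bell (R : comNzRingType) (n : nat) (y : R) :
  \sum_(k < n.+1) 'C(n, k)%:R * (A k)%:R * y ^+ k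
    = \sum_(k < n.+1)
        (-1) ^+ (n - k) * 'C(n, k)%:R * (y + 1) ^+ k * (bell k)%:R.
Proof.
under eq_bigr => k _ do rewrite A_bell mulr_sumr mulr_suml.
rewrite exchange_big /=; apply: eq_bigr => m _.
(* The expansion of [(y + 1) ^+ m] is padded to [n.+1] terms to match the sum over [k]; for [k > m]
   the left term vanishes through ['C(m, k)]. *)
rewrite exprD1n (big_ord_widen n.+1 (fun i => y ^+ i *+ 'C(m, i))) //.
rewrite [in RHS]big_mkcond mulr_sumr mulr_suml; apply: eq_bigr => k _.
transitivity ((-1) ^+ (n - m) * ('C(n, k) * 'C(n - k, n - m))%:R
                * y ^+ k * (bell m)%:R).
  by rewrite natrM; ring.
rewrite mul_bin_bin ?leq_ord // natrM ltnS; case: leqP => [_|lt_mk].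
  by rewrite -[y ^+ k *+ _]mulr_natl !mulrA.
by rewrite (bin_small lt_mk) !(mulr0, mul0r).
Qed.

Lemma sum_A_bell_signed (R : comNzRingType) (n : nat) (y : R) :
  \sum_(k < n.+1) (-1) ^+ (n - k) * 'C(n, k)%:R * (A k)%:R * (y + 1) ^+ k
    = \sum_(k < n.+1) 'C(n, k)%:R * y ^+ k * (bell k)%:R.
Proof.
have sgn (k : 'I_n.+1) : (-1) ^+ (n - k) = (-1) ^+ n * (-1) ^+ k :> R.
  by rewrite -signr_odd oddB -1?ltnS // signr_addb !signr_odd.
(* The sign [(-1) ^+ k] is absorbed into the power of [y + 1], which prepares the substitution of
   [- (y + 1)] for [y]. *)
transitivity ((-1) ^+ n *
    \sum_(k < n.+1) 'C(n, k)%:R * (A k)%:R * (- (y + 1)) ^+ k).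
  rewrite mulr_sumr; apply: eq_bigr => k _; rewrite sgn (exprNn (y + 1)).
  by ring.
rewrite sum_A_bell mulr_sumr; apply: eq_bigr => k _.
(* Here [- (y + 1) + 1 = - y], so every sign occurs twice and cancels. *)
rewrite opprD subrK (exprNn y) sgn.
transitivity (((-1) ^+ n) ^+ 2 * ((-1) ^+ k) ^+ 2
                * ('C(n, k)%:R * y ^+ k * (bell k)%:R)); first by ring.
by rewrite !sqrr_sign !mul1r.
Qed.

Theorem theorem3p1 (n : nat) :
  (\sum_(k < n.+1)
      (-1) ^+ (n - k) * 'C(n, k)%:R * (A k)%:R * ('X + 1) ^+ k
     = \sum_(k < n.+1) 'C(n, k)%:R * 'X ^+ k * (bell k)%:R :> {poly int})
  /\
  (\sum_(k < n.+1) 'C(n, k)%:R * (A k)%:R * 'X ^+ k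
     = \sum_(k < n.+1)
         (-1) ^+ (n - k) * 'C(n, k)%:R * ('X + 1) ^+ k * (bell k)%:R
       :> {poly int}).
Proof. by split; [apply: sum_A_bell_signed | apply: sum_A_bell]. Qed.
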